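(* Let $S$ be a completely regular finite semigroup. Then $S/\eta^{*}$ is a Clifford semigroup.
   Context: For a semigroup $S$, $S^1$ denotes $S$ if $S$ has an identity, and $S$ with an identity $1$ adjoined otherwise. For $x,y,z_1,z_2,\ldots$ in $S^1$ define recursively $\lambda_0=x$, $\rho_0=y$, and $\lambda_{n+1}=\lambda_n z_{n+1}\rho_n$, $\rho_{n+1}=\rho_n z_{n+1}\lambda_n$, where $\lambda_n=\lambda_n(x,y,z_1,\ldots,z_n)$ and $\rho_n=\rho_n(x,y,z_1,\ldots,z_n)$. For a semigroup $S$ let $\eta_1=\{(x,x)\mid x\in S\}$ and, for every integer $n>1$, let $x\,\eta_n\,y$ if and only if there exist $z_1,\ldots,z_n\in S^1$ such that $x=\lambda_n(x,y,z_1,\ldots,z_n)$ and $y=\rho_n(x,y,z_1,\ldots,z_n)$. Let $\eta$ be the transitive closure of $\bigcup_{i\ge 1}\eta_i$, and let $\eta^{*}$ be the smallest congruence on $S$ containing $\eta$. A semigroup is completely regular if every element lies in some subgroup of it. A Clifford semigroup is a semigroup that is both an inverse semigroup and a completely regular semigroup. *)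

(* Defs.v *)
From HB Require Import structures.
From Stdlib Require Import Relation_Definitions Relation_Operators.
From mathcomp Require Import all_boot.
From mathcomp Require Import boolp classical_sets functions cardinality.

Set Implicit Arguments.
Unset Strict Implicit.
Unset Printing Implicit Defensive.

Import Algebra.

Local Open Scope group_scope.

(* [adjoin1 S] always adjoins a new identity [None]; the carrier of S^1 is the
   submonoid [in_S1], which contains [None] only when S has no identity. *)
Definition adjoin1 (S : Type) : Type := option S.

HB.instance Definition _ (S : choiceType) := Choice.copy (adjoin1 S) (option S).

Section Adjoin1.

Variable S : semigroupType.

Definition adjoin1_mul (u v : adjoin1 S) : adjoin1 S :=
  match u, v with
  | Some a, Some b => Some (a * b)
  | Some a, None => Some a
  | None, _ => v
  end.

Lemma adjoin1_mulA : associative adjoin1_mul.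
Proof. by move=> [a|] [b|] [c|] //=; rewrite mulgA. Qed.

Lemma adjoin1_mul1 : left_id None adjoin1_mul.
Proof. by []. Qed.

Lemma adjoin1_mulr1 : right_id None adjoin1_mul.
Proof. by case. Qed.

HB.instance Definition _ := isMonoid.Build (adjoin1 S)
  adjoin1_mulA adjoin1_mul1 adjoin1_mulr1.

Definition adjoin1_in (x : S) : adjoin1 S := Some x.

Definition has_identity : Prop :=
  exists e : S, forall x : S, e * x = x /\ x * e = x.

Definition in_S1 (u : adjoin1 S) : Prop := u = None -> ~ has_identity.

End Adjoin1.

(* The pair (lambda_n, rho_n); the parameters are numbered from 1, so [z 0] is
   never used. *)
Fixpoint lambda_rho (M : magmaType) (x y : M) (z : nat -> M) (n : nat) : M * M :=
  if n is m.+1 then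
    let: (l, r) := lambda_rho x y z m in
    (l * z m.+1 * r, r * z m.+1 * l)
  else (x, y).

Definition lambda (M : magmaType) (x y : M) (z : nat -> M) (n : nat) : M :=
  (lambda_rho x y z n).1.

Definition rho (M : magmaType) (x y : M) (z : nat -> M) (n : nat) : M :=
  (lambda_rho x y z n).2.

Section Eta.

Variable S : semigroupType.

(* Meaningful for n >= 1 only. *)
Definition eta_ (n : nat) : relation S := fun x y =>
  if n == 1%N then x = y
  else exists z : nat -> adjoin1 S,
    [/\ forall i, (1 <= i <= n)%N -> in_S1 (z i),
        adjoin1_in x = lambda (adjoin1_in x) (adjoin1_in y) z n
      & adjoin1_in y = rho (adjoin1_in x) (adjoin1_in y) z n].

Definition eta : relation S :=
  clos_trans S (fun x y => exists2 n : nat, (1 <= n)%N & eta_ n x y).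

Definition is_congruence (E : relation S) : Prop :=
  equivalence S E /\
  forall x x' y y' : S, E x x' -> E y y' -> E (x * y) (x' * y').

Definition eta_star : relation S := fun x y =>
  forall E : relation S, is_congruence E -> inclusion S eta E -> E x y.

Lemma eta_star_congruence : is_congruence eta_star.
Proof.
split; first split.
- by move=> x E [[Er _ _] _] _; apply: Er.
- move=> x y z xy yz E cE sE; have [[_ Et _] _] := cE.
  by apply: (Et _ y); [apply: xy | apply: yz].
- move=> x y xy E cE sE; have [[_ _ Es] _] := cE.
  by apply: Es; apply: xy.
move=> x x' y y' xx' yy' E cE sE; have [_ Em] := cE.
by apply: Em; [apply: xx' | apply: yy'].
Qed.

End Eta.

Record congruence (S : semigroupType) := Congruence {
  congruence_rel :> S -> S -> Prop;
  congruenceP : is_congruence congruence_rel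
}.

Section Quotient.

Variables (S : semigroupType) (E : congruence S).

Definition congruenceb : rel S := fun x y => `[< E x y >].

Lemma congruenceb_refl : reflexive congruenceb.
Proof. by have [[Er _ _] _] := congruenceP E; move=> x; apply/asboolP/Er. Qed.

Lemma congruenceb_sym : symmetric congruenceb.
Proof.
have [[_ _ Es] _] := congruenceP E.
by move=> x y; apply/asboolP/asboolP; apply: Es.
Qed.

Lemma congruenceb_trans : transitive congruenceb.
Proof.
have [[_ Et _] _] := congruenceP E.
by move=> y x z /asboolP xy /asboolP yz; apply/asboolP/(Et _ y).
Qed.

Canonical congruence_equiv :=
  EquivRel congruenceb congruenceb_refl congruenceb_sym congruenceb_trans.

Definition quot : Type := {eq_quot congruence_equiv}%qT.

HB.instance Definition _ := EqQuotient.on quot.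
HB.instance Definition _ := Choice.on quot.

Local Open Scope quotient_scope.

Definition quot_mul : quot -> quot -> quot := lift_op2 quot (@mul S).

Lemma quot_piP (x y : S) : \pi_quot x = \pi_quot y <-> E x y.
Proof.
by split=> [/eqmodP/asboolP | Exy]; last apply/eqmodP/asboolP.
Qed.

Lemma quot_mul_pi (x y : S) : quot_mul (\pi x) (\pi y) = \pi_quot (x * y).
Proof.
have [_ Em] := congruenceP E; rewrite /quot_mul; unlock.
by apply/quot_piP; apply: Em; apply/quot_piP; rewrite reprK.
Qed.

Lemma quot_mulA : associative quot_mul.
Proof.
move=> u v w; rewrite -[u]reprK -[v]reprK -[w]reprK.
by rewrite !quot_mul_pi mulgA.
Qed.

HB.instance Definition _ := isSemigroup.Build quot quot_mulA.

End Quotient.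

Definition eta_star_cong (S : semigroupType) : congruence S :=
  Congruence (@eta_star_congruence S).

Section Classes.

Variable S : semigroupType.

Definition is_subgroup (G : set S) : Prop :=
  (forall x y, G x -> G y -> G (x * y)) /\
  exists2 e, G e & forall x, G x ->
    [/\ e * x = x, x * e = x & exists2 y, G y & x * y = e /\ y * x = e].

Definition completely_regular : Prop :=
  forall x : S, exists2 G : set S, is_subgroup G & G x.

Definition inverse_semigroup : Prop :=
  forall x : S, exists! y : S, x * y * x = x /\ y * x * y = y.

Definition clifford_semigroup : Prop :=
  inverse_semigroup /\ completely_regular.

End Classes.

(* Main.v *)
Require Import Defs.
From mathcomp Require Import all_boot.
From mathcomp Require Import boolp classical_sets functions cardinality.

(** L-related or R-related idempotents e, f satisfy e eta_2 f (take every z_i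
    equal to e), so they become equal in Q = S / eta^*.  If e, f are idempotents
    of S and g is the identity of a subgroup containing ef, then fg is an
    idempotent L-related to g and ge is an idempotent R-related to g; as eg = g
    and gf = g already hold in S, in Q the class k = [g] is fixed by
    multiplication by e and f on either side, whence [ef] = [ef] k = k.
    Symmetrically [fe] is such a class l, and computing kl in two ways gives
    k = l.  Idempotents of Q lift to S because S is a union of groups, so they
    commute in Q, and a completely regular semigroup with commuting idempotents
    is Clifford. *)

Import Algebra.
Local Open Scope group_scope.
Local Open Scope classical_set_scope.

Lemma clifford_of_idempotents_commute {S : semigroupType} :
  completely_regular S ->
  (forall e f : S, e * e = e -> f * f = f -> e * f = f * e) ->
  clifford_semigroup S.
Proof.
move=> crS comm; split=> // x.
have [G [_ [e Ge GP]] Gx] := crS x.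
have [ex _ [y Gy [xy yx]]] := GP x Gx; have [ey _ _] := GP y Gy.
exists y; split; first by rewrite xy yx ex ey.
move=> z [xzx zxz].
have idl u : x * u * x = x -> (x * u) * (x * u) = x * u.
  by move=> xux; rewrite mulgA xux.
have idr u : x * u * x = x -> (u * x) * (u * x) = u * x.
  by move=> xux; rewrite -mulgA (mulgA x) xux.
have xyx : x * y * x = x by rewrite xy ex.
have yxy : y * x * y = y by rewrite yx ey.
(* Both inverses equal [z * x * y]: in [y = (y * x) * (z * x) * y] and in
   [z = z * (x * y) * (x * z)] the two bracketed idempotents commute. *)
transitivity (z * x * y).
  rewrite -{1}yxy -{1}xzx -[in LHS]mulgA.
  have -> : y * (x * z * x * y) = (y * x) * (z * x) * y by rewrite !mulgA.
  by rewrite (comm _ _ (idr y xyx) (idr z xzx)) -!mulgA (mulgA y) yxy.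
rewrite -{2}zxz -{2}xyx.
have -> : z * (x * y * x) * z = z * ((x * y) * (x * z)) by rewrite !mulgA.
by rewrite (comm _ _ (idl y xyx) (idl z xzx)) !mulgA zxz.
Qed.

Section EtaStar.

Variable S : semigroupType.
Implicit Types e f g x y : S.

Lemma adjoin1_inM x y : adjoin1_in (x * y) = adjoin1_in x * adjoin1_in y.
Proof. by []. Qed.

Local Notation Q := (quot (eta_star_cong S)).
Local Notation pi := (\pi_Q)%qT.

Lemma pi_mul x y : pi (x * y) = pi x * pi y.
Proof. by rewrite -[RHS]/(quot_mul _ _) quot_mul_pi. Qed.

Lemma pi_eta2 x y : eta_ 2 x y -> pi x = pi y.
Proof.
move=> xy; have [_ ->] // := quot_piP (eta_star_cong S) x y.
by move=> E _; apply; apply: Relation_Operators.t_step; exists 2.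
Qed.

Lemma pi_idempotent_L e f : e * e = e -> e * f = e -> f * e = f -> pi e = pi f.
Proof.
move=> ee ef fe; apply: pi_eta2; exists (fun=> adjoin1_in e).
by split=> //; rewrite /lambda /rho /= -!adjoin1_inM !(ee, ef, fe).
Qed.

Lemma pi_idempotent_R e f : e * e = e -> e * f = f -> f * e = e -> pi e = pi f.
Proof.
(* One round swaps the pair, as [e * e * f = f] and [f * e * e = e]; the second round swaps it
   back. *)
move=> ee ef fe; apply: pi_eta2; exists (fun=> adjoin1_in e).
by split=> //; rewrite /lambda /rho /= -!adjoin1_inM !(ee, ef, fe).
Qed.

Lemma completely_regular_quot : completely_regular S -> completely_regular Q.
Proof.
move=> crS u; rewrite -[u]reprK; have [G [GM [e Ge GP]] Gu] := crS (repr u).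
exists (pi @` G); last by exists (repr u).
split=> [_ _ [x Gx <-] [y Gy <-]|].
  by exists (x * y); rewrite ?pi_mul //; apply: GM.
exists (pi e); first by exists e.
move=> _ [x Gx <-]; have [ex xe [y Gy [xy yx]]] := GP x Gx.
by split; rewrite -?pi_mul ?ex ?xe //; exists (pi y);
  [exists y | rewrite -!pi_mul xy yx].
Qed.

(** If [e = x * y] is the identity of a subgroup containing [x] and [u = [x]], then [[x] = [x][x][y]
    = [x][y] = [e]]. *)
Lemma quot_idempotent_lift (crS : completely_regular S) (u : Q) : u * u = u ->
  exists2 e : S, e * e = e & u = pi e.
Proof.
rewrite -[u]reprK; move: (repr u) => x {u} uu.
have [G [_ [e Ge GP]] Gx] := crS x.
have [_ xe [y _ [xy _]]] := GP x Gx; have [ee _ _] := GP e Ge.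
by exists e => //; rewrite -xe pi_mul -xy pi_mul mulgA uu.
Qed.

Lemma pi_mul_idempotents (crS : completely_regular S) e f :
    e * e = e -> f * f = f ->
  [/\ pi e * pi (e * f) = pi (e * f), pi (e * f) * pi e = pi (e * f),
      pi f * pi (e * f) = pi (e * f) & pi (e * f) * pi f = pi (e * f)].
Proof.
move=> ee ff; have [G [_ [g Gg GP]] Gef] := crS (e * f).
have [gg _ _] := GP g Gg; have [_ efg [w _ [efw wef]]] := GP _ Gef.
(* Write [g] as [e * f * w], respectively [w * (e * f)], to absorb [e] and [f]. *)
have eg : e * g = g by rewrite -efw !mulgA ee.
have gf : g * f = g by rewrite -wef -!mulgA ff.
have fk : pi f * pi g = pi g.
  rewrite -pi_mul; apply/esym/pi_idempotent_L => //.
    by rewrite mulgA gf.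
  by rewrite -mulgA gg.
have ke : pi g * pi e = pi g.
  rewrite -pi_mul; apply/esym/pi_idempotent_R => //.
    by rewrite mulgA gg.
  by rewrite -mulgA eg.
have -> : pi (e * f) = pi g.
  by rewrite -efg -mulgA !pi_mul fk -pi_mul eg.
by split; rewrite -?pi_mul ?eg ?gf // pi_mul.
Qed.

Lemma quot_idempotents_commute (crS : completely_regular S) (u v : Q) :
  u * u = u -> v * v = v -> u * v = v * u.
Proof.
move=> /(quot_idempotent_lift crS)[e ee ->] /(quot_idempotent_lift crS)[f ff ->].
have [_ ke _ kf] := pi_mul_idempotents crS _ _ ee ff.
have [fl _ el _] := pi_mul_idempotents crS _ _ ff ee.
(* The product is [[ef]], as [[ef]] absorbs [f] and [e] on the right, and [[fe]], as [[fe]] absorbs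
   them on the left. *)
rewrite -!pi_mul; transitivity (pi (e * f) * pi (f * e)).
  by rewrite [pi (f * e)]pi_mul mulgA kf ke.
by rewrite [pi (e * f)]pi_mul -mulgA fl el.
Qed.

End EtaStar.

Theorem theorem2p6 (S : semigroupType) (finS : finite_set [set: S])
    (crS : completely_regular S) :
  clifford_semigroup (quot (eta_star_cong S)).
Proof.
apply: clifford_of_idempotents_commute; first exact: completely_regular_quot.
exact: quot_idempotents_commute.
Qed.
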